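(* Let $\mathbf{R}$ be a commutative unital ring. An element $q = w+xi+yj+zk$ of $\mathcal{H}_{\mathbf{R}}$ (with $w,x,y,z\in\mathbf{R}$) is invertible in $\mathcal{H}_{\mathbf{R}}$ if and only if $\|q\|^{2} = w^{2}+x^{2}+y^{2}+z^{2} \in U(\mathbf{R})$.
   Context: For a commutative unital ring $\mathbf{R}$, $U(\mathbf{R})$ denotes its group of units. The ring of quaternions over $\mathbf{R}$ is $\mathcal{H}_{\mathbf{R}}=\{ w+xi+yj+zk \mid w,x,y,z\in \mathbf{R}\}$ (formal expressions, i.e. the free $\mathbf{R}$-module with basis $1,i,j,k$), with componentwise addition and $\mathbf{R}$-bilinear multiplication determined by the identity $1$ and the rules $i^{2}=j^{2}=k^{2}=-1$, $ij=k$, $jk=i$, $ki=j$, $ji=-k$, $kj=-i$, $ik=-j$. The conjugate of $q=w+xi+yj+zk$ is $q^{*}=w-xi-yj-zk$, and the squared norm is $\|q\|^{2}=qq^{*}=w^{2}+x^{2}+y^{2}+z^{2}\in\mathbf{R}$. *)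

(* Defs.v *)
From HB Require Import structures.
From mathcomp Require Import all_boot all_algebra.
From mathcomp Require Import ring.

Set Implicit Arguments.
Unset Strict Implicit.
Unset Printing Implicit Defensive.

Import GRing.Theory.
Local Open Scope ring_scope.

(* [GRing.unit] is only available on [unitRingType], i.e. for nonzero rings
   with decidable invertibility; this is the two-sided notion for an arbitrary,
   possibly noncommutative or trivial, ring. *)
Definition invertible (A : pzRingType) (a : A) : Prop :=
  exists b : A, a * b = 1 /\ b * a = 1.

(* [Quat w x y z] stands for w + xi + yj + zk, see [quatE]. *)
Record quat (R : Type) := Quat { qre : R; qim : R; qjm : R; qkm : R }.

Section QuatChoice.
Variable R : Type.

Definition tuple_of_quat (q : quat R) : R * R * R * R :=
  (qre q, qim q, qjm q, qkm q).
Definition quat_of_tuple (t : R * R * R * R) : quat R :=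
  let: (w, x, y, z) := t in Quat w x y z.

Lemma tuple_of_quatK : cancel tuple_of_quat quat_of_tuple.
Proof. by case. Qed.
End QuatChoice.

HB.instance Definition _ (R : eqType) :=
  Equality.copy (quat R) (can_type (@tuple_of_quatK R)).
HB.instance Definition _ (R : choiceType) :=
  Choice.copy (quat R) (can_type (@tuple_of_quatK R)).

Section QuatRing.
Variable R : comPzRingType.
Implicit Types (a : R) (p q : quat R).

Definition quat_add p q : quat R :=
  Quat (qre p + qre q) (qim p + qim q) (qjm p + qjm q) (qkm p + qkm q).
Definition quat_opp q : quat R :=
  Quat (- qre q) (- qim q) (- qjm q) (- qkm q).
Definition quat_scale a q : quat R :=
  Quat (a * qre q) (a * qim q) (a * qjm q) (a * qkm q).

Definition quat_mul p q : quat R :=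
  let: Quat a b c d := p in
  let: Quat e f g h := q in
  Quat (a * e - b * f - c * g - d * h)
       (a * f + b * e + c * h - d * g)
       (a * g - b * h + c * e + d * f)
       (a * h + b * g - c * f + d * e).

Lemma quat_addA : associative quat_add.
Proof. by move=> p q r; rewrite /quat_add /= !addrA. Qed.
Lemma quat_addC : commutative quat_add.
Proof. by move=> p q; congr Quat; rewrite addrC. Qed.
Lemma quat_add0 : left_id (Quat 0 0 0 0) quat_add.
Proof. by case=> *; rewrite /quat_add /= !add0r. Qed.
Lemma quat_addN : left_inverse (Quat 0 0 0 0) quat_opp quat_add.
Proof. by case=> *; rewrite /quat_add /= !addNr. Qed.

HB.instance Definition _ := GRing.isZmodule.Build (quat R)
  quat_addA quat_addC quat_add0 quat_addN.

Lemma quat_mulA : associative quat_mul.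
Proof. by case=> ? ? ? ? [? ? ? ?] [? ? ? ?]; congr Quat; ring. Qed.
Lemma quat_mul1l : left_id (Quat 1 0 0 0) quat_mul.
Proof. by case=> *; congr Quat; ring. Qed.
Lemma quat_mul1r : right_id (Quat 1 0 0 0) quat_mul.
Proof. by case=> *; congr Quat; ring. Qed.
Lemma quat_mulDl : left_distributive quat_mul +%R.
Proof. by case=> ? ? ? ? [? ? ? ?] [? ? ? ?]; congr Quat => /=; ring. Qed.
Lemma quat_mulDr : right_distributive quat_mul +%R.
Proof. by case=> ? ? ? ? [? ? ? ?] [? ? ? ?]; congr Quat => /=; ring. Qed.

HB.instance Definition _ := GRing.Zmodule_isPzRing.Build (quat R)
  quat_mulA quat_mul1l quat_mul1r quat_mulDl quat_mulDr.

Lemma quat_scaleA a b q : quat_scale a (quat_scale b q) = quat_scale (a * b) q.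
Proof. by case: q => *; congr Quat => /=; rewrite mulrA. Qed.
Lemma quat_scale1 : left_id 1 quat_scale.
Proof. by case=> *; congr Quat => /=; rewrite mul1r. Qed.
Lemma quat_scaleDr : right_distributive quat_scale +%R.
Proof. by move=> a p q; congr Quat => /=; rewrite mulrDr. Qed.
Lemma quat_scaleDl q : {morph quat_scale^~ q : a b / a + b}.
Proof. by move=> a b; congr Quat => /=; rewrite mulrDl. Qed.

HB.instance Definition _ := GRing.Zmodule_isLmodule.Build R (quat R)
  quat_scaleA quat_scale1 quat_scaleDr quat_scaleDl.

Definition qi : quat R := Quat 0 1 0 0.
Definition qj : quat R := Quat 0 0 1 0.
Definition qk : quat R := Quat 0 0 0 1.

Lemma quatE (w x y z : R) :
  Quat w x y z = w *: (1 : quat R) + x *: qi + y *: qj + z *: qk.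
Proof. by congr Quat => /=; ring. Qed.

Lemma quat_scalerAl a p q : a *: (p * q) = (a *: p) * q.
Proof. by case: p q => ? ? ? ? [? ? ? ?]; congr Quat => /=; ring. Qed.
Lemma quat_scalerAr a p q : a *: (p * q) = p * (a *: q).
Proof. by case: p q => ? ? ? ? [? ? ? ?]; congr Quat => /=; ring. Qed.

Lemma quat_table :
  [/\ qi * qi = -1, qj * qj = -1 & qk * qk = -1] /\
  [/\ qi * qj = qk, qj * qk = qi & qk * qi = qj] /\
  [/\ qj * qi = - qk, qk * qj = - qi & qi * qk = - qj].
Proof. by do !split; congr Quat => /=; ring. Qed.

Definition quat_conj q : quat R :=
  Quat (qre q) (- qim q) (- qjm q) (- qkm q).

(* q q^* lies in R.1 by [sqnormE]; [sqnorm q] is the corresponding element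
   of R. *)
Definition sqnorm q : R := qre (q * quat_conj q).

Lemma sqnormE q : q * quat_conj q = sqnorm q *: (1 : quat R).
Proof. by case: q => *; rewrite /sqnorm; congr Quat => /=; ring. Qed.

End QuatRing.

Arguments qi {R}.
Arguments qj {R}.
Arguments qk {R}.

(* Main.v *)
Require Import Defs.
From mathcomp Require Import all_boot all_algebra.
From mathcomp Require Import ring.
Import GRing.Theory.
Local Open Scope ring_scope.

(** The squared norm is multiplicative ([sqnormM], Euler's four-square
    identity) and sends 1 to 1, so it carries an inverse of [q] to an inverse
    of [sqnorm q]. Conversely, [q] commutes with its conjugate and their
    product is the scalar [sqnorm q] ([sqnormE] and [sqnormEl]); when that
    scalar has an inverse [b], the quaternion [b *: quat_conj q] is therefore a
    two-sided inverse of [q]. Both directions are polynomial identities in the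
    coordinates, which is why they hold over every commutative ring. *)

Lemma sqnorm_sum_squares (R : comPzRingType) (w x y z : R) :
  sqnorm (Quat w x y z) = w ^+ 2 + x ^+ 2 + y ^+ 2 + z ^+ 2.
Proof. by rewrite /sqnorm /=; ring. Qed.

Lemma sqnorm1 (R : comPzRingType) : sqnorm (1 : quat R) = 1.
Proof. by rewrite sqnorm_sum_squares; ring. Qed.

(** With squared norms written as sums of squares, this is Euler's four-square
    identity. *)
Lemma sqnormM (R : comPzRingType) (p q : quat R) :
  sqnorm (p * q) = sqnorm p * sqnorm q.
Proof.
by case: p q => ? ? ? ? [? ? ? ?]; rewrite !sqnorm_sum_squares; ring.
Qed.

(** The left-handed companion of [sqnormE]: since the multiplication is not
    commutative, a two-sided inverse needs both. *)
Lemma sqnormEl (R : comPzRingType) (q : quat R) :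
  quat_conj q * q = sqnorm q *: (1 : quat R).
Proof. by case: q => *; rewrite sqnorm_sum_squares; congr Quat => /=; ring. Qed.

Lemma invertible_sqnorm (R : comPzRingType) (q : quat R) :
  invertible q -> invertible (sqnorm q).
Proof.
by case=> p [qp1 pq1]; exists (sqnorm p); rewrite -!sqnormM qp1 pq1 sqnorm1.
Qed.

Lemma sqnorm_invertible (R : comPzRingType) (q : quat R) :
  invertible (sqnorm q) -> invertible q.
Proof.
case=> b [_ bN1]; exists (b *: quat_conj q).
rewrite -quat_scalerAr -quat_scalerAl sqnormE sqnormEl.
by rewrite scalerA bN1 scale1r.
Qed.

Theorem proposition1 (R : comPzRingType) (w x y z : R) (q : quat R)
    (hq : q = w *: (1 : quat R) + x *: qi + y *: qj + z *: qk) :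
  sqnorm q = w ^+ 2 + x ^+ 2 + y ^+ 2 + z ^+ 2 /\
  (invertible q <-> invertible (sqnorm q)).
Proof.
split; first by rewrite hq -quatE sqnorm_sum_squares.
by split; [apply: invertible_sqnorm | apply: sqnorm_invertible].
Qed.
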